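(* Let $X$ be a finite index set, $M\in\mathbb{R}^{X\times X}$ a real symmetric matrix, and $K\subset X$ a non-empty subset. Then $M$ exhibits pretty good fractional revival with respect to $K$ if and only if the partition $\mathcal{P}_K$ is non-degenerate. Furthermore, if $M$ is primitive and $M$ exhibits pretty good fractional revival with respect to $K$, then $\operatorname{cl}\{\exp(itM)_{K\times K} : t\ge 0\}\cap U(K)$ contains a non-diagonal matrix.
   Context: For a matrix $A\in\mathbb{C}^{X\times X}$, $A_{K\times K}$ is the submatrix with rows and columns indexed by $K$; $U(K)$ is the set of unitary $K\times K$ matrices; $\operatorname{cl}$ denotes topological closure. $M$ exhibits pretty good fractional revival with respect to $K$ if $\operatorname{cl}\{\exp(itM)_{K\times K}: t\ge 0\}\cap U(K)\nsubseteq\{\rho\,\mathrm{Id}_{K\times K}:\rho\in\mathbb{C}\}$, i.e. this closure contains a unitary matrix with at least two distinct eigenvalues. Let $M=\sum_{i=1}^d\theta_iE_i$ be the spectral decomposition ($\theta_i$ the distinct eigenvalues, $E_i$ the orthogonal projections onto the eigenspaces). $D_K$ is the $X\times X$ diagonal matrix with diagonal entries $1$ in $K$ and $0$ outside $K$. The eigenvalue support of $K$ is the binary relation $\Phi_K=\{(\theta_a,\theta_b): E_aD_KE_b\neq 0\}$. The partition $\mathcal{P}_K=(\Pi_0,\Pi_1,\dots,\Pi_s)$ of $\{1,\dots,d\}$ is defined by $\Pi_0=\{i:(E_i)_{K\times K}=0\}$ (possibly empty), and $\Pi_1,\dots,\Pi_s$ are the remaining equivalence classes of the transitive closure of $\Phi_K$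 (viewed as a relation on indices). $\|x\|=\min\{|x-n|:n\in\mathbb{Z}\}$ for real $x$. $\mathcal{P}_K$ is non-degenerate if there is a vector $(\rho_1,\dots,\rho_s)\in\mathbb{R}^s$, not constant mod 1 (i.e. not all $\rho_r$ are congruent mod 1), such that for every $\varepsilon>0$ there is $t>0$ with $\|t\theta_j-\rho_r\|<\varepsilon$ for all $1\le r\le s$ and all $j\in\Pi_r$. (No condition is imposed on indices in $\Pi_0$.) A square matrix is primitive if it is entrywise nonnegative and some power of it has all entries positive. *)

(* Defs.v *)
From HB Require Import structures.
From mathcomp Require Import all_boot all_order all_algebra complex.
From mathcomp Require Import all_classical all_reals all_analysis.

Set Implicit Arguments.
Unset Strict Implicit.
Unset Printing Implicit Defensive.

Import Order.TTheory GRing.Theory Num.Theory numFieldNormedType.Exports.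

Local Open Scope ring_scope.
Local Open Scope complex_scope.

(* The limit is taken in the entrywise topology of 'M[C]_n induced by the norm
   of C; it is only meant to be used for C = R[i] with R : realType. *)
Definition expmx (C : numFieldType) (n : nat) (A : 'M[C]_n) : 'M[C]_n :=
  limn (series (fun k => (k`!%:R)^-1 *: A ^+ k : 'M[C]_n)).

(* Rows and columns are listed in the increasing order of K. *)
Definition principal_submx (T : Type) (n : nat) (K : {set 'I_n}) (A : 'M[T]_n) :
    'M[T]_#|K| :=
  mxsub (@enum_val _ (mem K)) (@enum_val _ (mem K)) A.
Arguments principal_submx {T n} K A.

Definition mx_closure (C : numFieldType) (n : nat) (S : set 'M[C]_n) :
    set 'M[C]_n :=
  closure S.

Section FractionalRevival.
Variables (R : realType) (n : nat).
Implicit Types (M : 'M[R]_n) (K : {set 'I_n}).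

Definition transition_mx M (t : R) : 'M[R[i]]_n :=
  expmx (('i * t%:C) *: map_mx (real_complex R) M).

Definition revival_set M K : set 'M[R[i]]_#|K| :=
  (mx_closure [set principal_submx K (transition_mx M t) | t in [set t | 0 <= t]]
     `&` [set U | U \is unitarymx])%classic.
Arguments revival_set M K : clear implicits.

Definition pretty_good_fractional_revival M K : Prop :=
  ~ (revival_set M K `<=` [set rho%:M | rho in [set: R[i]]])%classic.

Definition orthogonal_projection_onto (m : nat) (V : 'M[R]_(m, n))
    (E : 'M[R]_n) : Prop :=
  [/\ E^T = E, E *m E = E & (E :=: V)%MS].

(* For a symmetric M, the left eigenvectors spanning the row space of
   [eigenspace M a] are the transposes of the right ones. *)
Definition spectral_decomposition M (d : nat) (theta : 'I_d -> R)
    (E : 'I_d -> 'M[R]_n) : Prop :=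
  [/\ injective theta,
      forall a : R, eigenvalue M a <-> exists i, theta i = a,
      forall i, orthogonal_projection_onto (eigenspace M (theta i)) (E i)
    & M = \sum_(i < d) theta i *: E i].

Definition indicator_mx K : 'M[R]_n := diag_mx (\row_(x < n) (x \in K)%:R).

Section Partition.
Variables (d : nat) (E : 'I_d -> 'M[R]_n) (K : {set 'I_n}).

Definition eigenvalue_support : rel 'I_d :=
  fun a b => E a *m indicator_mx K *m E b != 0.

(* [connect] is the reflexive transitive closure; prefixing one step gives the
   transitive closure. *)
Definition eigenvalue_support_tc : rel 'I_d :=
  fun a b => [exists c, eigenvalue_support a c && connect eigenvalue_support c b].

Definition Pi0 : {set 'I_d} :=
  [set j : 'I_d | principal_submx K (E j) == 0]%SET.

(* The set {Pi_1, ..., Pi_s}. *)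
Definition support_classes : {set {set 'I_d}} :=
  equivalence_partition eigenvalue_support_tc (~: Pi0)%SET.

End Partition.

Definition dist_int (x : R) : R :=
  inf [set `|x - z%:~R| | z in [set: int]]%classic.

(* s = #|support_classes E K|, and Pi_r is [enum_val r]. *)
Definition nondegenerate_partition (d : nat) (theta : 'I_d -> R)
    (E : 'I_d -> 'M[R]_n) K : Prop :=
  exists rho : 'I_#|support_classes E K| -> R,
    ~ (forall r1 r2, exists z : int, rho r1 - rho r2 = z%:~R) /\
    forall eps : R, 0 < eps ->
      exists2 t : R, 0 < t &
        forall (r : 'I_#|support_classes E K|) (j : 'I_d),
          j \in enum_val r -> dist_int (t * theta j - rho r) < eps.

Definition primitive_mx M : Prop :=
  (forall i j, 0 <= M i j) /\
  exists2 k : nat, (0 < k)%N & forall i j, 0 < (M ^+ k : 'M[R]_n) i j.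

End FractionalRevival.

Arguments revival_set {R n} M K.

(* Main.v *)
Require Import Defs.
From HB Require Import structures.
From mathcomp Require Import all_boot all_order all_algebra complex.
From mathcomp Require Import all_classical all_reals all_analysis.
From mathcomp Require Import ring lra.

Set Implicit Arguments.
Unset Strict Implicit.
Unset Printing Implicit Defensive.

Import Order.TTheory GRing.Theory Num.Theory numFieldNormedType.Exports.

Local Open Scope ring_scope.
Local Open Scope complex_scope.
Local Open Scope classical_set_scope.

(** Write [e x] for [cis x], that is, [exp (2 pi i x)].  If
    [M = sum_j theta_j E_j] then
    [exp (i t M) = sum_j e (t theta_j / 2 pi) E_j], so the orbit of [M] is a
    curve inside the image of the torus under
    [x |-> V x := sum_j e (x_j) E_j].  The torus is compact, hence every [U] in
    the closure of the [K]-blocks of the orbit is the block of some [V x], and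
    [x] is itself a limit of the phases [t theta_j / 2 pi] modulo 1
    ([closure_orbit_torus]).  Conversely a phase vector [x] approximated by the
    orbit, at least where [(E_j)_KK] is nonzero, has its block in the closure
    ([torus_closure_orbit]).

    What remains is algebra.  Let [D] be the indicator matrix of [K].  The matrix
    [V x] is unitary, so its block is unitary exactly when [V x] is block
    diagonal, that is, commutes with [D] ([unitary_blockP]).  Compressing the
    commutation relation to [E_a _ E_b] gives
    [(e x_a - e x_b) E_a D E_b = 0]: the phases must agree along the eigenvalue
    support, hence on each class of the partition ([spectral_sum_commP]).  The
    block is moreover scalar exactly when all the phases outside [Pi_0] agree
    ([principal_spectral_sumP]).  So a nonscalar unitary block is the same thing
    as a phase for each class, not all equal modulo 1, that the orbit
    approximates simultaneously; this is nondegeneracy.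

    For primitive [M] no further limit point has to be constructed: any nonscalar
    [U] in the revival set is already non-diagonal.  Indeed [M] has an eigenvector
    [w] without zero entry ([perron_eigenvector]), it is an eigenvector of
    [V x], and since [V x] is block diagonal the restriction of [w] to [K] is an
    eigenvector of [U].  A diagonal matrix having an eigenvector without zero
    entry is scalar. *)

(** * The circle and the exponential series *)

Section ComplexLimits.
Variable R : realType.
Implicit Types (x y : R).

Lemma normc_le_ReIm (z : R[i]) : `|z| <= (`|complex.Re z| + `|complex.Im z|)%:C.
Proof.
rewrite [X in `|X| <= _]complexE (le_trans (ler_normD _ _))// normrM.
by rewrite !normc_def /= expr0n /= !add0r expr1n !addr0 sqrtr1 mul1r
   !sqrtr_sqr rmorphD.
Qed.

(* The topology of [R[i]] is inherited from its structure of numeric field and is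
   found only through this projection. *)
Local Notation C :=
  (Num.NumField.sort (complex_complex__canonical__Num_NumField R)).

Lemma cvg_complex (T : Type) (F : set_system T) (FF : Filter F)
    (f g : T -> R) (a b : R) :
  f @ F --> a -> g @ F --> b ->
  (fun t => (f t +i* g t : R[i])) @ F --> (a +i* b : C).
Proof.
move=> fa gb; apply/(@cvgrPdist_lt _ C) => e e0.
have [Re0 eE] : 0 < complex.Re e /\ e = (complex.Re e)%:C.
  move: e0; case: e => e1 e2; rewrite ltcE /= => /andP[/eqP -> ?]; split=> //.
have e20 : 0 < complex.Re e / 2 by rewrite divr_gt0.
near=> t.
apply: le_lt_trans (normc_le_ReIm _) _; rewrite eE ltcR /=.
rewrite [ltRHS]splitr ltrD//; near: t.
  by move/cvgrPdist_lt: fa; apply.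
by move/cvgrPdist_lt: gb; apply.
Unshelve. all: by end_near. Qed.

(** The phase is measured in turns, so that [cis] factors through the reals
    modulo 1. *)
Definition cis y : C := cos (pi *+ 2 * y) +i* sin (pi *+ 2 * y).

Lemma continuous_cis : continuous cis.
Proof.
move=> y; apply: cvg_complex.
  apply: (@continuous_comp _ _ _ (fun y => pi *+ 2 * y) cos);
    last exact: continuous_cos.
  exact: mulrl_continuous.
apply: (@continuous_comp _ _ _ (fun y => pi *+ 2 * y) sin);
    last exact: continuous_sin.
exact: mulrl_continuous.
Qed.

Lemma normr_cis y : `|cis y| = 1.
Proof. by rewrite normc_def /= cos2Dsin2 sqrtr1. Qed.

Lemma cisD x y : cis (x + y) = cis x * cis y.
Proof.
rewrite /cis mulrDr cosD sinD; simpc; congr (_ +i* _).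
by rewrite addrC mulrC [X in _ + X]mulrC addrC [X in _ + X]mulrC.
Qed.

Lemma cis_nat (n : nat) : cis n%:R = 1.
Proof.
by rewrite /cis mulr_natr -[_ *+ n]add0r (periodicn (@cosD2pi R))
   (periodicn (@sinD2pi R)) cos0 sin0.
Qed.

Lemma cis_int (z : int) : cis z%:~R = 1.
Proof.
case: z => n; first exact: cis_nat.
rewrite NegzE mulrNz /cis mulrN cosN sinN.
by case: (cis_nat n.+1) => -> ->; rewrite oppr0.
Qed.

(** Subtracting the floor reduces to [y] in [0, 1), where [cos (2 pi y) = 1]
    forces [sin (pi y) = 0]. *)
Lemma cis_eq1 y : cis y = 1 -> exists z : int, y = z%:~R.
Proof.
move=> cy; exists (Num.floor y); apply/eqP; rewrite -subr_eq0.
set f := y - _; have f0 : 0 <= f by rewrite subr_ge0 floor_le_tmp.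
have f1 : f < 1 by rewrite ltrBlDl -[ltRHS](intrD1) floorD1_gt.
have : cis f = 1 by rewrite /f -mulrNz cisD cy cis_int mulr1.
rewrite /cis => -[cf _].
have : sin (pi * f) = 0.
  apply/eqP; rewrite -sqrf_eq0 sin2cos2.
  move: cf; rewrite mulrnAl cos_mulr2n => cf.
  have -> : cos (pi * f) ^+ 2 = 1 by move: cf; lra.
  by rewrite subrr.
move=> sf; case: (eqVneq f 0) => // fn0.
have : 0 < sin (pi * f).
  by apply: sin_gt0_pi; rewrite mulr_gt0 ?pi_gt0 ?lt0r ?fn0//= gtr_pMr ?pi_gt0.
by rewrite sf ltxx.
Qed.

Lemma cis_eq x y : cis x = cis y <-> exists z : int, x - y = z%:~R.
Proof.
split=> [xy|[z xyz]]; last by rewrite -[x](subrK y) xyz cisD cis_int mul1r.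
apply: cis_eq1; rewrite cisD xy -cisD subrr; exact: (cis_nat 0).
Qed.

Lemma dist_int_lt y (e : R) :
  dist_int y < e <-> exists z : int, `|y - z%:~R| < e.
Proof.
have lb : has_inf [set `|y - z%:~R| | z in [set: int]].
  by split; [exists `|y - 0%:~R|, 0 | exists 0 => _ [z _ <-]].
split=> [ye|[z yz]].
  by have [_ [z _ <-] ?] := inf_lt lb.1 ye; exists z.
by apply: le_lt_trans yz; apply: ge_inf; [case: lb | exists z].
Qed.

(** The partial sums of the exponential series at [i y] have those of the cosine
    and sine series as real and imaginary parts. *)
Lemma cvg_expi_series y :
  series (fun k => (k`!%:R)^-1 * ('i * y%:C) ^+ k : C) @ \oo -->
  (cos y +i* sin y : C).
Proof.
have coefE k : (k`!%:R)^-1 * ('i * y%:C) ^+ k =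
    cos_coeff y k +i* sin_coeff y k :> R[i].
  rewrite exprMn.
  have sgnE m : (-1) ^+ m = ((-1) ^+ m : R)%:C :> R[i].
    by rewrite rmorphXn rmorphN1.
  have -> : 'i ^+ k = ((~~ odd k)%:R * (-1) ^+ k./2) +i*
                      ((odd k)%:R * (-1) ^+ k.-1./2) :> R[i].
    rewrite -[in LHS](odd_double_half k); case: (boolP (odd k)) => ok /=.
      have -> : (k.-1)./2 = k./2.
        by rewrite -[in LHS](odd_double_half k) ok /= doubleK.
      rewrite add1n exprS -muln2 mulnC exprM sqr_i mul0r mul1r.
      by rewrite sgnE; simpc.
    rewrite add0n -muln2 mulnC exprM sqr_i mul1r mul0r.
    by rewrite sgnE.
  have -> : (k`!%:R)^-1 = ((k`!%:R)^-1 : R)%:C :> R[i].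
    by rewrite fmorphV rmorph_nat.
  rewrite -rmorphXn /cos_coeff /sin_coeff /=; simpc.
  by congr (_ +i* _); rewrite mulrC.
have -> : series (fun k => (k`!%:R)^-1 * ('i * y%:C) ^+ k) =
  (fun n => series (cos_coeff y) n +i* series (sin_coeff y) n : R[i]).
  apply/funext => n; rewrite /series /=.
  elim: n => [|n IH]; first by rewrite !big_geq.
  by rewrite !big_nat_recr //= IH coefE.
apply: cvg_complex.
  by rewrite cos.unlock; apply: is_cvg_series_cos_coeff.
by rewrite sin.unlock; apply: is_cvg_series_sin_coeff.
Qed.

End ComplexLimits.

(** * Blocks of unitary matrices and resolutions of the identity *)

Local Open Scope sesquilinear_scope.

Section Selection.
Variables (R : pzRingType) (n : nat) (K : {set 'I_n}).

(** Taking a principal submatrix is compression by this co-isometry, which turns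
    statements on blocks into matrix algebra. *)
Definition select_mx : 'M[R]_(#|K|, n) :=
  rowsub (@enum_val _ (mem K)) 1%:M.

Lemma principal_submxE (A : 'M[R]_n) :
  principal_submx K A = select_mx *m A *m select_mx^T.
Proof.
apply/matrixP => i j; rewrite !mxE (bigD1 (enum_val j)) //= big1 => [|k kj].
  rewrite addr0 !mxE eqxx mulr1 (bigD1 (enum_val i)) //= big1 => [|k ki].
    by rewrite !mxE eqxx mul1r addr0.
  by rewrite !mxE eq_sym (negPf ki) mul0r.
by rewrite !mxE eq_sym (negPf kj) mulr0.
Qed.

Definition diag_indicator : 'M[R]_n := diag_mx (\row_(x < n) (x \in K)%:R).

Lemma select_mulT : select_mx *m select_mx^T = 1%:M.
Proof.
have := principal_submxE 1%:M; rewrite mulmx1 => <-; apply/matrixP => i j.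
by rewrite !mxE (inj_eq enum_val_inj).
Qed.

Lemma select_Tmul : select_mx^T *m select_mx = diag_indicator.
Proof.
apply/matrixP => x y; rewrite !mxE.
have [xK|xNK] := boolP (x \in K).
  have [i xE] : exists i : 'I_#|K|, enum_val i = x.
    by exists (enum_rank_in xK x); rewrite enum_rankK_in.
  rewrite (bigD1 i) //= big1 => [|k ki].
    by rewrite !mxE xE eqxx mul1r addr0.
  by rewrite !mxE -xE (inj_eq enum_val_inj) (negPf ki) mul0r.
rewrite mul0rn big1 // => k _; rewrite !mxE.
case: eqP => [kE|]; last by rewrite mul0r.
by move: xNK; rewrite -kE enum_valP.
Qed.

End Selection.
Arguments select_mx R {n} K.
Arguments diag_indicator R {n} K.

Section UnitaryBlock.
Variables (C : numClosedFieldType) (n : nat) (K : {set 'I_n}).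
Local Notation S := (select_mx C K).
Local Notation D := (diag_indicator C K).

Lemma conj_select : map_mx Num.conj S = S.
Proof. by apply/matrixP => i j; rewrite !mxE conjC_nat. Qed.

Lemma select_tC : S^t* = S^T.
Proof. by rewrite -map_trmx conj_select. Qed.

Lemma select_mulD : S *m D = S.
Proof. by rewrite -select_Tmul mulmxA select_mulT mul1mx. Qed.

Lemma mul_selectTD : D *m S^T = S^T.
Proof. by rewrite -select_Tmul -mulmxA select_mulT mulmx1. Qed.

Lemma diag_indicatorT : D^T = D.
Proof. exact: tr_diag_mx. Qed.

Lemma conj_diag_indicator : map_mx Num.conj D = D.
Proof. by rewrite -select_Tmul map_mxM conj_select select_tC. Qed.

Lemma diag_indicatorM : D *m D = D.
Proof. by rewrite -{1}select_Tmul -mulmxA select_mulD select_Tmul. Qed.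

Lemma mulmx_tCr_eq0 m p (B : 'M[C]_(m, p)) : B *m B^t* = 0 -> B = 0.
Proof.
move=> BB; apply/matrixP => i j; rewrite mxE; apply/eqP.
have := congr1 (fun A : 'M[C]_m => A i i) BB; rewrite !mxE.
move/eqP; rewrite psumr_eq0 => [|k _]; last by rewrite !mxE mul_conjC_ge0.
by move/allP => /(_ j); rewrite mem_index_enum !mxE mul_conjC_eq0 => /(_ isT).
Qed.

Lemma mulmx_tCl_eq0 m p (B : 'M[C]_(m, p)) : B^t* *m B = 0 -> B = 0.
Proof.
move=> BB; have /(congr1 (fun X => X^t*)) : B^t* = 0.
  by apply: mulmx_tCr_eq0; rewrite trmxCK.
by rewrite trmxCK trmx0 map_mx0.
Qed.

(** The rows of [V] and those of its block both have norm 1, so nothing is left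
    outside the block: with [B = S V (1 - D)] one finds [B B^t* = 0]. *)
Lemma unitary_block_mulD (V : 'M[C]_n) :
  V \is unitarymx -> principal_submx K V \is unitarymx -> S *m V *m D = S *m V.
Proof.
move=> Vu /unitarymxP Uu; apply/eqP; rewrite -subr_eq0; apply/eqP.
apply: mulmx_tCr_eq0.
rewrite principal_submxE !trmx_mul !map_mxM trmxK select_tC conj_select in Uu.
have adjD : D^t* = D by rewrite diag_indicatorT conj_diag_indicator.
rewrite linearB /= map_mxB mulmxBl !mulmxBr !trmx_mul !map_mxM adjD.
have SVVS : S *m V *m (V^t* *m S^t*) = 1%:M.
  rewrite mulmxA -(mulmxA S) (unitarymxP Vu) mulmx1 select_tC.
  exact: select_mulT.
have SVDVS : S *m V *m D *m (V^t* *m S^t*) = 1%:M.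
  by rewrite -Uu -select_Tmul !mulmxA select_tC.
have -> : S *m V *m D *m (D *m (V^t* *m S^t*)) = S *m V *m D *m (V^t* *m S^t*).
  by rewrite !mulmxA -(mulmxA _ D D) diag_indicatorM.
rewrite SVDVS (mulmxA _ D) SVDVS SVVS !subrr //.
Qed.

(** A unitary corner of a unitary matrix forces the off-diagonal blocks to vanish;
    the columns are treated by passing to the adjoint. *)
Lemma unitary_blockP (V : 'M[C]_n) : V \is unitarymx ->
  (principal_submx K V \is unitarymx) <-> V *m D = D *m V.
Proof.
move=> Vu; split=> [Uu|VD].
  have DVD : D *m V *m D = D *m V.
    by rewrite -select_Tmul -!mulmxA (mulmxA S) select_Tmul unitary_block_mulD.
  have Vu' : V^t* \is unitarymx by rewrite trmxC_unitary.
  have Uu' : principal_submx K (V^t*) \is unitarymx.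
    suff -> : principal_submx K (V^t*) = (principal_submx K V)^t*.
      by rewrite trmxC_unitary.
    by apply/matrixP => i j; rewrite !mxE.
  have DVD' : D *m V^t* *m D = D *m V^t*.
    by rewrite -select_Tmul -!mulmxA (mulmxA S) select_Tmul unitary_block_mulD.
  move/(congr1 (fun X => X^t*)): DVD'.
  rewrite !trmx_mul !map_mxM trmxCK diag_indicatorT conj_diag_indicator mulmxA.
  by rewrite DVD => ->.
apply/unitarymxP; rewrite principal_submxE !trmx_mul !map_mxM trmxK.
rewrite select_tC conj_select.
have -> : S *m V *m S^T *m (S *m (V^t* *m S^T)) =
          S *m (V *m D) *m V^t* *m S^T by rewrite -select_Tmul !mulmxA.
by rewrite VD mulmxA select_mulD -(mulmxA S) (unitarymxP Vu) mulmx1 select_mulT.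
Qed.

End UnitaryBlock.

Section Resolution.
Variables (C : numClosedFieldType) (n d : nat) (E : 'I_d -> 'M[C]_n).

(** Attaching no eigenvalues to the projections covers both those onto the
    eigenspaces and those onto the lines of an orthonormal eigenbasis. *)
Definition resolution_of_identity : Prop :=
  [/\ forall i, (E i)^t* = E i,
      forall i j, E i *m E j = if i == j then E i else 0
    & \sum_i E i = 1%:M].

Definition spectral_sum (l : 'I_d -> C) : 'M[C]_n := \sum_i l i *: E i.

Hypothesis resE : resolution_of_identity.
Implicit Types l : 'I_d -> C.

Lemma mul_proj_spectral_sum l i : E i *m spectral_sum l = l i *: E i.
Proof.
have [_ EE _] := resE.
rewrite /spectral_sum mulmx_sumr (bigD1 i) //= big1 => [|j ji].
  by rewrite addr0 -scalemxAr EE eqxx.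
by rewrite -scalemxAr EE eq_sym (negPf ji) scaler0.
Qed.

Lemma mul_spectral_sum_proj l i : spectral_sum l *m E i = l i *: E i.
Proof.
have [_ EE _] := resE.
rewrite /spectral_sum mulmx_suml (bigD1 i) //= big1 => [|j ji].
  by rewrite addr0 -scalemxAl EE eqxx.
by rewrite -scalemxAl EE (negPf ji) scaler0.
Qed.

Lemma spectral_sumM l1 l2 :
  spectral_sum l1 *m spectral_sum l2 = spectral_sum (fun i => l1 i * l2 i).
Proof.
rewrite {1}/spectral_sum mulmx_suml; apply: eq_bigr => i _.
by rewrite -scalemxAl mul_proj_spectral_sum scalerA.
Qed.

Lemma spectral_sum1 : spectral_sum (fun=> 1) = 1%:M.
Proof. by have [_ _ <-] := resE; apply: eq_bigr => i _; rewrite scale1r. Qed.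

Lemma spectral_sumX l k : spectral_sum l ^+ k = spectral_sum (fun i => l i ^+ k).
Proof.
elim: k => [|k IH]; first by rewrite expr0 -[LHS]spectral_sum1.
rewrite exprS IH -[_ * _]/(_ *m _) spectral_sumM.
by apply: eq_bigr => i _; rewrite exprS.
Qed.

Lemma spectral_sum_adj l :
  (spectral_sum l)^t* = spectral_sum (fun i => Num.conj (l i)).
Proof.
have [Eadj _ _] := resE.
rewrite /spectral_sum linear_sum raddf_sum; apply: eq_bigr => i _.
by rewrite linearZ /= map_mxZ Eadj.
Qed.

Lemma spectral_sum_unitary l :
  (forall i, `|l i| = 1) -> spectral_sum l \is unitarymx.
Proof.
move=> l1; apply/unitarymxP; rewrite spectral_sum_adj spectral_sumM -spectral_sum1.
by apply: eq_bigr => i _; rewrite -normCK l1 expr1n.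
Qed.

(** Compressing [[sum_i l i *: E i, A] = 0] by [E a] and [E b] multiplies
    [E a *m A *m E b] by [l a - l b], and these compressions add up to [A]. *)
Lemma spectral_sum_commP l (A : 'M[C]_n) :
  (spectral_sum l *m A = A *m spectral_sum l) <->
  (forall a b, E a *m A *m E b != 0 -> l a = l b).
Proof.
have [_ _ sumE] := resE; split=> [lA a b nz|h].
  have /eqP : (l a - l b) *: (E a *m A *m E b) = 0.
    rewrite scalerBl [l b *: _]scalemxAr -(mul_spectral_sum_proj l) 2!scalemxAl.
    by rewrite -(mul_proj_spectral_sum l) mulmxA -!(mulmxA (E a)) lA !mulmxA subrr.
  by rewrite scaler_eq0 (negPf nz) orbF subr_eq0 => /eqP.
have e1 b : spectral_sum l *m A *m E b = \sum_a l b *: (E a *m A *m E b).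
  rewrite {1}/spectral_sum 2!mulmx_suml; apply: eq_bigr => a _.
  rewrite -!scalemxAl; have [->|/h ->//] := eqVneq (E a *m A *m E b) 0.
  by rewrite !scaler0.
have e2 a : E a *m (A *m spectral_sum l) = \sum_b l b *: (E a *m A *m E b).
  rewrite mulmxA /spectral_sum mulmx_sumr.
  by apply: eq_bigr => b _; rewrite -scalemxAr.
transitivity (\sum_b spectral_sum l *m A *m E b).
  by rewrite -mulmx_sumr sumE mulmx1.
transitivity (\sum_a E a *m (A *m spectral_sum l)); last first.
  by rewrite -mulmx_suml sumE mul1mx.
by rewrite (eq_bigr _ (fun b _ => e1 b)) (eq_bigr _ (fun a _ => e2 a))
   exchange_big.
Qed.

Variable K : {set 'I_n}.
Local Notation S := (select_mx C K).
Local Notation D := (diag_indicator C K).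

(** The block of [E a] is the Gram matrix [B^t* *m B] of [B = E a *m S^T]. *)
Lemma principal_proj_eq0 a : (principal_submx K (E a) == 0) = (E a *m D == 0).
Proof.
have [Eadj EE _] := resE; apply/eqP/eqP => [|ED].
  rewrite principal_submxE => /eqP SES.
  suff SE : E a *m S^T = 0 by rewrite -select_Tmul mulmxA SE mul0mx.
  apply: mulmx_tCl_eq0; rewrite trmx_mul map_mxM trmxK conj_select Eadj.
  by rewrite mulmxA -(mulmxA S) EE eqxx; apply/eqP.
by rewrite principal_submxE -mulmxA -(mul_selectTD C K) (mulmxA (E a)) ED
   mul0mx mulmx0.
Qed.

(** [E a *m D *m E a] is the Gram matrix of [E a *m D]. *)
Lemma proj_block_eq0 a : (E a *m D *m E a == 0) = (E a *m D == 0).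
Proof.
have [Eadj EE _] := resE; apply/eqP/eqP => [ED|->]; last by rewrite mul0mx.
apply: mulmx_tCr_eq0; rewrite trmx_mul map_mxM Eadj diag_indicatorT
  conj_diag_indicator.
by rewrite mulmxA -(mulmxA (E a)) diag_indicatorM.
Qed.

(** Since the sum commutes with [D], its block is [mu%:M] exactly when its product
    with [D] is [mu *: D]; then multiply by each [E a]. *)
Lemma principal_spectral_sumP l mu : spectral_sum l *m D = D *m spectral_sum l ->
  (principal_submx K (spectral_sum l) = mu%:M) <->
  (forall a, E a *m D != 0 -> l a = mu).
Proof.
have [_ _ sumE] := resE; move=> lD; split=> [sc a nz|h].
  have VD : spectral_sum l *m D = mu *: D.
    rewrite -{1}diag_indicatorM mulmxA lD -{1}select_Tmul -{1}select_Tmul.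
    rewrite -!mulmxA (mulmxA S) (mulmxA _ _ S) -principal_submxE sc.
    by rewrite mul_scalar_mx -scalemxAr select_Tmul.
  have /eqP : (l a - mu) *: (E a *m D) = 0.
    by rewrite scalerBl scalemxAl -mul_proj_spectral_sum -mulmxA VD -scalemxAr
       subrr.
  by rewrite scaler_eq0 (negPf nz) orbF subr_eq0 => /eqP.
have VD : spectral_sum l *m D = mu *: D.
  rewrite -[D in RHS]mul1mx -sumE /spectral_sum !mulmx_suml scaler_sumr.
  apply: eq_bigr => a _; rewrite -scalemxAl.
  by have [->|/h ->//] := eqVneq (E a *m D) 0; rewrite !scaler0.
rewrite principal_submxE -(mul_selectTD C K) -mulmxA (mulmxA (spectral_sum l)) VD.
by rewrite -scalemxAl -scalemxAr mul_selectTD select_mulT scalemx1.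
Qed.

End Resolution.

(** * An eigenvector without zero entry *)

Section Perron.
Variables (R : realType) (n d : nat) (E : 'I_d -> 'M[R[i]]_n).
Hypothesis resE : resolution_of_identity E.
Variable theta : 'I_d -> R.
Local Notation M := (spectral_sum E (fun i => (theta i)%:C)).

Lemma sqnorm_mx (x : 'cV[R[i]]_n) :
  (x^t* *m x) 0 0 = \sum_i `|x i 0| ^+ 2.
Proof. by rewrite mxE; apply: eq_bigr => i _; rewrite !mxE mulrC normCK. Qed.

Lemma quad_spectral_sum l (x : 'cV[R[i]]_n) :
  (x^t* *m spectral_sum E l *m x) 0 0 =
  \sum_j l j * ((E j *m x)^t* *m (E j *m x)) 0 0.
Proof.
have [Eadj EE _] := resE.
rewrite /spectral_sum mulmx_sumr mulmx_suml summxE; apply: eq_bigr => j _.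
rewrite -scalemxAr -scalemxAl mxE trmx_mul map_mxM Eadj !mulmxA.
by rewrite -(mulmxA _ (E j) (E j)) EE eqxx.
Qed.

(** Take the largest eigenvalue [theta i0], a nonzero vector [v] of its eigenspace
    and [w = |v|], which has the same norm.  As [M] is nonnegative, its quadratic
    form is at least as large at [w] as at [v], where it is maximal for that norm;
    so [w] attains the maximum too and lies in the eigenspace.  Then
    [M ^+ k *m w], which has positive entries, is a multiple of [w].  The
    conclusion is stated on the projections because they need not be indexed by
    distinct eigenvalues. *)
Lemma perron_eigenvector k : (0 < n)%N ->
    (forall x y, 0 <= M x y) -> (forall x y, 0 < (M ^+ k : 'M[R[i]]_n) x y) ->
  exists i0 (w : 'cV[R[i]]_n), (forall x, w x 0 != 0) /\
    (forall j, theta j != theta i0 -> E j *m w = 0).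
Proof.
have [Eadj EE sumE] := resE.
move=> n0 M0 Mk0.
have [i1 Ei1] : exists i, E i != 0.
  apply/existsP; rewrite -negb_forall; apply/negP => /forallP E0.
  have := sumE; rewrite big1 => [/matrixP/(_ (Ordinal n0) (Ordinal n0))|i _].
    by rewrite !mxE eqxx => /eqP; rewrite eq_sym oner_eq0.
  by apply/eqP; apply: E0.
case: (@Order.TotalTheory.arg_maxP _ _ _ i1 (fun i => E i != 0) theta Ei1)
  => i0 Ei0 max0.
have [y vy] : exists y, col y (E i0) != 0.
  apply/existsP; rewrite -negb_forall; apply: contraNN Ei0 => /forallP E0.
  apply/eqP/matrixP => x y; have /eqP/matrixP/(_ x 0) := E0 y.
  by rewrite !mxE.
set v := col y (E i0) in vy.
have Mv : M *m v = (theta i0)%:C *: v.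
  by rewrite /v colE mulmxA mul_spectral_sum_proj // scalemxAl.
pose w : 'cV[R[i]]_n := map_mx Num.norm v.
have w0 x : 0 <= w x 0 by rewrite mxE.
exists i0, w.
have sqw : \sum_j ((E j *m w)^t* *m (E j *m w)) 0 0 = \sum_i `|v i 0| ^+ 2.
  have := quad_spectral_sum (fun=> 1) w; rewrite spectral_sum1 // mulmx1 sqnorm_mx.
  under [X in X = _ -> _]eq_bigr do rewrite mxE normr_id.
  by move=> ->; apply: eq_bigr => j _; rewrite mul1r.
have quadvw : (theta i0)%:C * \sum_i `|v i 0| ^+ 2 <= (w^t* *m M *m w) 0 0.
  have -> : (theta i0)%:C * \sum_i `|v i 0| ^+ 2 = (v^t* *m M *m v) 0 0.
    by rewrite -mulmxA Mv -scalemxAr mxE sqnorm_mx.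
  have vreal : (v^t* *m M *m v) 0 0 \is Num.real.
    rewrite -mulmxA Mv -scalemxAr mxE sqnorm_mx realM //; last first.
      by apply: ger0_real; rewrite sumr_ge0 // => i _; rewrite exprn_ge0.
    by apply/complex_realP; exists (theta i0).
  apply: le_trans (real_ler_norm vreal) _.
  rewrite mxE (le_trans (ler_norm_sum _ _ _)) // mxE ler_sum // => z _.
  rewrite normrM [w z 0]mxE ler_wpM2r // mxE (le_trans (ler_norm_sum _ _ _)) //.
  rewrite mxE ler_sum // => x _.
  by rewrite normrM !mxE norm_conjC conj_normC (ger0_norm (M0 _ _)).
have Ew j : theta j != theta i0 -> E j *m w = 0.
  move=> jne.
  have gap0 j' :
      0 <= (theta i0 - theta j')%:C * ((E j' *m w)^t* *m (E j' *m w)) 0 0.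
    have [->|Ej] := eqVneq (E j') 0.
      by rewrite mul0mx mulmx0 mxE mulr0.
    rewrite mulr_ge0 //; first by rewrite ler0c subr_ge0; apply: max0.
    by rewrite sqnorm_mx sumr_ge0 // => x _; rewrite exprn_ge0.
  have gapS :
      \sum_j' (theta i0 - theta j')%:C *
        ((E j' *m w)^t* *m (E j' *m w)) 0 0 = 0.
    apply/eqP; rewrite eq_le sumr_ge0 ?andbT; last by move=> ? _; apply: gap0.
    move: quadvw; rewrite -sqw quad_spectral_sum mulr_sumr -subr_le0 -sumrB.
    by under eq_bigr do rewrite -mulrBl -rmorphB.
  move/eqP: gapS; rewrite psumr_eq0; last by move=> ? _; apply: gap0.
  move/allP => /(_ j); rewrite mem_index_enum => /(_ isT) /=.
  rewrite mulf_eq0 => /orP[/eqP/(@complexI R)/eqP|/eqP q0].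
    by rewrite subr_eq0 eq_sym (negPf jne).
  apply: mulmx_tCl_eq0; apply/matrixP => a b; rewrite !ord1 q0 mxE //.
split=> // x.
have Mkw : (M ^+ k : 'M[R[i]]_n) *m w = ((theta i0)%:C ^+ k) *: w.
  rewrite spectral_sumX // /spectral_sum mulmx_suml.
  rewrite -[w in RHS]mul1mx -sumE mulmx_suml scaler_sumr.
  apply: eq_bigr => j _; rewrite -scalemxAl.
  by have [->//|/Ew ->] := eqVneq (theta j) (theta i0); rewrite !scaler0.
have [z vz] : exists z, v z 0 != 0.
  apply/existsP; rewrite -negb_forall; apply: contraNN vy => /forallP v0.
  by apply/eqP/colP => z; rewrite [RHS]mxE; apply/eqP.
have : 0 < ((M ^+ k : 'M[R[i]]_n) *m w) x 0.
  rewrite mxE (bigD1 z) //= ltr_wpDr //.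
    by rewrite sumr_ge0 // => i _; rewrite mulr_ge0 // ltW.
  by rewrite mulr_gt0 // mxE normr_gt0.
rewrite Mkw mxE; apply: contraTneq => ->; by rewrite mulr0 ltxx.
Qed.

End Perron.

(** * The closure of the orbit *)

Definition frac_part (R : realType) (y : R) : R := y - (Num.floor y)%:~R.

Section Orbit.
Variable R : realType.
Local Notation C :=
  (Num.NumField.sort (complex_complex__canonical__Num_NumField R)).

Lemma cvg_spectral_sum (T : Type) (F : set_system T) (FF : Filter F) (m d : nat)
    (B : 'I_d -> 'M[C]_m) (l : T -> 'I_d -> C) (a : 'I_d -> C) :
  (forall j, l t j @[t --> F] --> a j) ->
  (spectral_sum B (l t) : 'M[C]_m) @[t --> F] --> (spectral_sum B a : 'M[C]_m).
Proof.
move=> la; rewrite /spectral_sum.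
elim: (index_enum _) => [|j r IH].
  under eq_fun do rewrite big_nil.
  by rewrite big_nil; apply: cvg_cst.
under eq_fun do rewrite big_cons.
rewrite big_cons; apply: cvgD; last exact: IH.
by apply: cvgZr_tmp.
Qed.

Variables (n d : nat) (M : 'M[R]_n) (K : {set 'I_n}).
Variables (E : 'I_d -> 'M[R[i]]_n) (theta : 'I_d -> R).
Hypothesis resE : resolution_of_identity E.
Hypothesis ME :
  map_mx (real_complex R) M = spectral_sum E (fun j => (theta j)%:C).

(** In turns: the argument of [exp (i t theta_j)] divided by [2 pi]. *)
Definition angle (t : R) (j : 'I_d) : R := t * theta j / (pi *+ 2).

(** The exponential series of [i t M] is computed on each projection. *)
Lemma transition_mxE t :
  transition_mx M t = spectral_sum E (fun j => cis (angle t j)).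
Proof.
apply: (@cvg_lim _ (@norm_hausdorff _ 'M[C]_n)).
have -> : series (fun k => (k`!%:R)^-1 *:
      (('i * t%:C) *: map_mx (real_complex R) M) ^+ k : 'M[C]_n) =
    (fun N => spectral_sum E (fun j =>
      series (fun k => (k`!%:R)^-1 * ('i * (t * theta j)%:C) ^+ k : C) N)).
  apply/funext => N; rewrite /series /=.
  have step k : (('i * t%:C) *: map_mx (real_complex R) M) ^+ k =
     spectral_sum E (fun j => ('i * (t * theta j)%:C) ^+ k).
    rewrite -spectral_sumX //; congr (_ ^+ k); rewrite ME /spectral_sum scaler_sumr.
    by apply: eq_bigr => j _; rewrite scalerA rmorphM mulrA.
  under eq_bigr do rewrite step /spectral_sum scaler_sumr.
  rewrite exchange_big /=; apply: eq_bigr => j _.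
  by rewrite scaler_suml; apply: eq_bigr => k _; rewrite scalerA.
apply: cvg_spectral_sum => j; rewrite /cis /angle.
have -> : pi *+ 2 * (t * theta j / (pi *+ 2)) = t * theta j.
  by rewrite mulrC divfK // mulrn_eq0 /= gt_eqF // pi_gt0.
exact: cvg_expi_series.
Qed.

Lemma cis_frac_part y : cis (frac_part y) = cis y :> R[i].
Proof.
by apply/cis_eq; exists (- Num.floor y); rewrite /frac_part addrC addKr mulrNz.
Qed.

Lemma frac_part_itv (y : R) : 0 <= frac_part y <= 1.
Proof.
rewrite /frac_part subr_ge0 floor_le lerBlDl -[leRHS](intrD1).
by rewrite ltW // floorD1_gt.
Qed.

Lemma principal_spectral_sum l :
  principal_submx K (spectral_sum E l) =
  spectral_sum (fun j => principal_submx K (E j)) l.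
Proof.
apply/matrixP => a b; rewrite !mxE /spectral_sum !summxE; apply: eq_bigr => j _.
by rewrite !mxE.
Qed.

(** The coordinates are real representatives of points of the circle, which makes
    [torus_mx] a continuous map on a normed space whose restriction to the unit
    cube has the same image. *)
Definition torus_mx (x : 'rV[R]_d) : 'M[C]_#|K| :=
  principal_submx K (spectral_sum E (fun j => cis (x 0 j))).

Lemma continuous_torus_mx : continuous torus_mx.
Proof.
rewrite [torus_mx](_ : _ = fun x : 'rV[R]_d =>
    spectral_sum (fun j => principal_submx K (E j)) (fun j => cis (x 0 j))); last first.
  by apply/funext => x; rewrite /torus_mx principal_spectral_sum.
move=> x; apply: (@cvg_spectral_sum _ (nbhs x) (nbhs_filter x) _ _ _
  (fun y j => cis (y 0 j))) => j.
apply: (@continuous_comp _ _ _ (fun x : 'rV[R]_d => x 0 j) (@cis R)).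
  exact: coord_continuous.
exact: continuous_cis.
Qed.

Definition orbit_set : set 'M[C]_#|K| :=
  [set principal_submx K (transition_mx M t) | t in [set t | 0 <= t]].

(** The orbit is the image under [torus_mx] of fractional parts of the phases.
    These lie in the unit cube, so their closure is compact and its image is a
    closed set containing the orbit.  The approximation is kept on fractional
    parts rather than modulo 1, so that equal phases have equal limits. *)
Lemma closure_orbit_torus (U : 'M[C]_#|K|) :
  closure orbit_set U ->
  exists2 x : 'rV[R]_d, U = torus_mx x &
    forall e : R, 0 < e -> exists2 t, 0 <= t &
      forall j, `|frac_part (angle t j) - x 0 j| < e.
Proof.
pose A : set 'rV[R]_d :=
  [set \row_j frac_part (angle t j) | t in [set t : R | 0 <= t]].
pose Q : set 'rV[R]_d := [set v | forall j, `[0, 1] (v 0 j)].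
have Qc : compact Q.
  by apply: (@rV_compact R d (fun=> `[0, 1])) => j; apply: segment_compact.
have AQ : A `<=` Q.
  by move=> _ [t _ <-] j; rewrite mxE /= in_itv /=; apply: frac_part_itv.
have cAQ : closure A `<=` Q.
  have /closure_id -> : closed Q.
    by apply: compact_closed => //; apply: norm_hausdorff.
  exact: closureS.
have cAc : compact (closure A).
  exact: subclosed_compact (@closed_closure _ A) Qc cAQ.
have imc : closed (torus_mx @` closure A).
  apply: compact_closed; first exact: norm_hausdorff.
  apply: continuous_compact cAc.
  by apply: continuous_subspaceT => x; apply: continuous_torus_mx.
have orb : orbit_set `<=` torus_mx @` closure A.
  move=> _ [t t0 <-]; exists (\row_j frac_part (angle t j)).
    by apply: subset_closure; exists t.
  rewrite transition_mxE /torus_mx; congr (principal_submx K _).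
  by apply: eq_bigr => j _; rewrite mxE cis_frac_part.
move=> /(closureS orb); move/closure_id : imc => <- [x Ax <-].
exists x => // e e0.
have [_ [[t t0 <-] /= xe]] := Ax _ (nbhsx_ballx x e e0).
exists t => // j; have [_ /(_ 0 j)] := xe.
by rewrite mxE /ball /= distrC.
Qed.

(** Continuity of [torus_mx] at [x].  Coordinates with [(E j)_KK = 0] do not
    influence the block, so there the approximating point may keep the value of
    [x]. *)
Lemma torus_closure_orbit (x : 'rV[R]_d) :
  (forall e : R, 0 < e -> exists2 t, 0 <= t &
     forall j, principal_submx K (E j) != 0 -> dist_int (angle t j - x 0 j) < e) ->
  closure orbit_set (torus_mx x).
Proof.
move=> xapp B /(continuous_torus_mx) /= /nbhs_ballP[e /= e0 eB].
have [t t0 tj] := xapp e e0.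
have /choice[z zP] j : exists z : int, principal_submx K (E j) != 0 ->
    `|angle t j - x 0 j - z%:~R| < e.
  have [Ej|Ej] := eqVneq (principal_submx K (E j)) 0; first by exists 0.
  by have /dist_int_lt[z zP] := tj j Ej; exists z.
pose y : 'rV[R]_d := \row_j
  (if principal_submx K (E j) == 0 then x 0 j else angle t j - (z j)%:~R).
have yW : torus_mx y = principal_submx K (transition_mx M t).
  rewrite transition_mxE /torus_mx !principal_spectral_sum; apply: eq_bigr => j _.
  rewrite mxE; have [->|Ej] := eqVneq; first by rewrite !scaler0.
  congr (_ *: _); apply/cis_eq; exists (- z j).
  by rewrite addrAC subrr add0r mulrNz.
exists (torus_mx y); split; first by rewrite yW; exists t.
apply: eB; split=> // a j; rewrite ord1 mxE /ball /=.
have [_|Ej] := eqVneq; first by rewrite subrr normr0.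
by rewrite distrC addrAC zP.
Qed.

End Orbit.

(** * Spectral decompositions and the classes of the eigenvalue support *)

Section Bridge.
Variable R : realType.
Local Notation toC := (map_mx (real_complex R)).

(** Projections for distinct eigenvalues are orthogonal because [M] is symmetric.
    Their sum [P] satisfies [P *m M = M], so the rows of [1 - P] are in the kernel
    of [M]; were [P != 1], the value 0 would be one of the eigenvalues and [1 - P]
    would be absorbed by its projection, which it annihilates. *)
Lemma spectral_decomposition_resolution (n d : nat) (M : 'M[R]_n)
    (theta : 'I_d -> R) (E : 'I_d -> 'M[R]_n) : M^T = M ->
  spectral_decomposition M theta E ->
  resolution_of_identity (fun j => toC (E j)).
Proof.
move=> symM [thetaI eigE projE ME].
have EM i : E i *m M = theta i *: E i.
  by have [_ _ EV] := projE i; apply/eigenspaceP; rewrite EV.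
have ET i : (E i)^T = E i by case: (projE i).
have EE i : E i *m E i = E i by case: (projE i).
have ME' i : M *m E i = theta i *: E i.
  by rewrite -[M *m E i]trmxK trmx_mul symM ET EM linearZ /= ET.
have EE0 i j : i != j -> E i *m E j = 0.
  move=> ij; have /eqP : (theta i - theta j) *: (E i *m E j) = 0.
    by rewrite scalerBl scalemxAl -EM scalemxAr -ME' mulmxA subrr.
  by rewrite scaler_eq0 subr_eq0 (inj_eq thetaI) (negPf ij) => /eqP.
pose P := \sum_i E i.
have PE i : P *m E i = E i.
  rewrite /P mulmx_suml (bigD1 i) //= big1 ?addr0 // => j ji.
  exact: EE0.
have PM : P *m M = M.
  by rewrite /P mulmx_suml [RHS]ME; apply: eq_bigr => i _; rewrite EM.
have P1 : P = 1%:M.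
  apply/eqP; rewrite eq_sym -subr_eq0; apply/negPn/negP => Q0.
  have QM : (1%:M - P) *m M = 0 *: (1%:M - P).
    by rewrite mulmxBl mul1mx PM subrr scale0r.
  have Q0M : (1%:M - P <= eigenspace M 0)%MS by apply/eigenspaceP.
  have /eigE[i thi] : eigenvalue M 0.
    by apply: contraNneq Q0 => M0; move: Q0M; rewrite M0 submx0.
  have [_ _ EV] := projE i.
  move: Q0M; rewrite -thi -EV => /submxP[X QX].
  have : (1%:M - P) *m E i = 1%:M - P by rewrite QX -mulmxA EE.
  rewrite mulmxBl mul1mx PE subrr => Q00.
  by rewrite -Q00 eqxx in Q0.
split.
- move=> i; rewrite map_trmx ET; apply/matrixP => a b; rewrite !mxE.
  exact: conjc_real.
- move=> i j; rewrite -map_mxM; case: eqVneq => [->|ij]; first by rewrite EE.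
  by rewrite EE0 // map_mx0.
- have <- : toC P = \sum_i toC (E i) by rewrite /P raddf_sum.
  by rewrite P1 map_mx1.
Qed.

Lemma spectral_decomposition_sumE (n d : nat) (M : 'M[R]_n)
    (theta : 'I_d -> R) (E : 'I_d -> 'M[R]_n) :
  spectral_decomposition M theta E ->
  toC M = spectral_sum (fun j => toC (E j)) (fun j => (theta j)%:C).
Proof.
case=> _ _ _ ->; rewrite raddf_sum; apply: eq_bigr => j _.
exact: map_mxZ.
Qed.

(** The projections are those onto the lines of a complex orthonormal eigenbasis,
    so that [theta] lists the eigenvalues with multiplicity. *)
Lemma symmetric_resolution (n : nat) (M : 'M[R]_n) : M^T = M ->
  exists (theta : 'I_n -> R) (E : 'I_n -> 'M[R[i]]_n),
    resolution_of_identity E /\ toC M = spectral_sum E (fun j => (theta j)%:C).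
Proof.
move=> symM.
have herm : toC M \is hermsymmx.
  apply/is_hermitianmxP; rewrite expr0 scale1r map_trmx symM.
  by apply/matrixP => a b; rewrite !mxE; apply/esym; apply: conjc_real.
have := orthomx_spectralP (hermitian_normalmx herm).
have := hermitian_spectral_diag_real herm.
have := spectral_unitarymx (toC M).
set P := spectralmx _; set sp := spectral_diag _ => Pu /mxOverP spR.
rewrite invmx_unitary // => MP.
exists (fun j => complex.Re (sp 0 j)), (fun j => P^t* *m delta_mx j j *m P).
have PP : P *m P^t* = 1%:M by apply/unitarymxP.
split; first split.
- move=> j; rewrite !trmx_mul !map_mxM trmxCK mulmxA; congr (_ *m _ *m _).
  by rewrite trmx_delta map_delta_mx.
- move=> i j; rewrite !mulmxA -(mulmxA _ P) PP mulmx1 -(mulmxA (P^t*)).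
  rewrite mul_delta_mx_cond.
  by case: eqP => [->|_]; rewrite ?mulr1n // mulr0n mulmx0 mul0mx.
- rewrite -mulmx_suml -mulmx_sumr.
  have -> : \sum_i delta_mx i i = 1%:M :> 'M[R[i]]_n.
    by rewrite mx1_sum_delta.
  by rewrite mulmx1; apply: mulmx1C.
rewrite MP diag_mx_sum_delta mulmx_sumr mulmx_suml; apply: eq_bigr => j _.
by rewrite RRe_real ?spR // -scalemxAr -scalemxAl.
Qed.

Lemma connect_invariant (T : finType) (A : Type) (e : rel T) (f : T -> A) :
  (forall a b, e a b -> f a = f b) -> forall a b, connect e a b -> f a = f b.
Proof.
move=> fe a _ /connectP[p + ->]; elim: p a => //= c p IH a /andP[/fe -> /IH].
by [].
Qed.

Section Classes.
Variables (n d : nat) (E : 'I_d -> 'M[R]_n) (K : {set 'I_n}).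
Hypothesis resE : resolution_of_identity (fun j => toC (E j)).
Local Notation D := (diag_indicator R[i] K).

Lemma eigenvalue_supportE a b :
  eigenvalue_support E K a b = (toC (E a) *m D *m toC (E b) != 0).
Proof.
rewrite /eigenvalue_support; congr (~~ _).
have -> : D = toC (indicator_mx R K).
  apply/matrixP => x y; rewrite !mxE rmorphMn /=.
  by case: (x \in K).
by rewrite -!map_mxM map_mx_eq0.
Qed.

Lemma notin_Pi0 j : (j \in ~: Pi0 E K)%SET = (toC (E j) *m D != 0).
Proof.
rewrite !inE -(principal_proj_eq0 resE); congr (~~ _).
rewrite -[LHS](map_mx_eq0 (real_complex R)); congr (_ == _).
by apply/matrixP => x y; rewrite !mxE.
Qed.

(** This is what makes the transitive closure of the support reflexive, hence an
    equivalence relation, outside [Pi0]. *)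
Lemma eigenvalue_support_refl j :
  (j \in ~: Pi0 E K)%SET = eigenvalue_support E K j j.
Proof. by rewrite notin_Pi0 eigenvalue_supportE (proj_block_eq0 resE). Qed.

Lemma eigenvalue_support_sym : symmetric (eigenvalue_support E K).
Proof.
have [Eadj _ _] := resE.
suff imp a b : eigenvalue_support E K a b -> eigenvalue_support E K b a.
  by move=> a b; apply/idP/idP; apply: imp.
rewrite !eigenvalue_supportE; apply: contraNN => /eqP/(congr1 (fun X => X^t*)).
rewrite !trmx_mul !map_mxM diag_indicatorT conj_diag_indicator trmx0 map_mx0.
by rewrite (Eadj a) (Eadj b) mulmxA => ->.
Qed.

Lemma eigenvalue_support_Pi0 a b : eigenvalue_support E K a b ->
  (a \in ~: Pi0 E K)%SET && (b \in ~: Pi0 E K)%SET.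
Proof.
suff imp c d' : eigenvalue_support E K c d' -> (c \in ~: Pi0 E K)%SET.
  by move=> ab; rewrite (imp _ _ ab) (imp b a) // eigenvalue_support_sym.
rewrite notin_Pi0 eigenvalue_supportE; apply: contraNN => /eqP ->.
by rewrite mul0mx.
Qed.

Lemma eigenvalue_support_tcE a b : (a \in ~: Pi0 E K)%SET ->
  eigenvalue_support_tc E K a b = connect (eigenvalue_support E K) a b.
Proof.
rewrite eigenvalue_support_refl => aa; apply/existsP/idP => [[c /andP[ac]]|ab].
  exact/connect_trans/connect1.
by exists a; rewrite aa.
Qed.

Lemma support_classes_partition :
  finset.partition (support_classes E K) (~: Pi0 E K)%SET.
Proof.
apply: equivalence_partitionP => x y z xD yD zD.
rewrite !eigenvalue_support_tcE //; split=> // xy.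
exact: (same_connect (sym_connect_sym eigenvalue_support_sym)).
Qed.

Lemma mem_support_class j : (j \in ~: Pi0 E K)%SET ->
  exists r : 'I_#|support_classes E K|, j \in enum_val r.
Proof.
have /and3P[/eqP cov _ _] := support_classes_partition.
rewrite -cov => /finset.bigcupP[B BP jB].
by exists (enum_rank_in BP B); rewrite enum_rankK_in.
Qed.

Lemma support_class_sub (r : 'I_#|support_classes E K|) j :
  j \in enum_val r -> (j \in ~: Pi0 E K)%SET.
Proof.
have /and3P[/eqP cov _ _] := support_classes_partition.
move=> jr; rewrite -cov; apply/finset.bigcupP; exists (enum_val r) => //.
exact: enum_valP.
Qed.

Lemma support_class_neq0 (r : 'I_#|support_classes E K|) :
  exists j, j \in enum_val r.
Proof.
have /and3P[_ _ set0P] := support_classes_partition.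
apply/set0Pn; apply: contraNneq set0P => <-; exact: enum_valP.
Qed.

Lemma support_class_inj (r1 r2 : 'I_#|support_classes E K|) j :
  j \in enum_val r1 -> j \in enum_val r2 -> r1 = r2.
Proof.
have /and3P[_ tI _] := support_classes_partition.
move=> j1 j2; apply: enum_val_inj.
by rewrite -(def_pblock tI (enum_valP r1) j1) (def_pblock tI (enum_valP r2) j2).
Qed.

Lemma support_class_connect (r : 'I_#|support_classes E K|) a b :
  a \in enum_val r -> b \in enum_val r ->
  connect (eigenvalue_support E K) a b.
Proof.
have /imsetP[x xD ->] := enum_valP r.
rewrite !finset.in_set => /andP[_ xa] /andP[_ xb]; move: xa xb.
rewrite !eigenvalue_support_tcE //; move=> xa xb; apply: connect_trans xb.
by rewrite (sym_connect_sym eigenvalue_support_sym).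
Qed.

Lemma support_class_closed (r : 'I_#|support_classes E K|) a b :
  eigenvalue_support E K a b -> a \in enum_val r -> b \in enum_val r.
Proof.
move=> ab; have /andP[_ bD] := eigenvalue_support_Pi0 ab.
have /imsetP[x xD ->] := enum_valP r.
rewrite !finset.in_set => /andP[_ xa]; apply/andP; split.
  by move: bD; rewrite !finset.in_set.
move: xa; rewrite !eigenvalue_support_tcE // => /connect_trans; apply.
exact: connect1.
Qed.

End Classes.
End Bridge.

(** * Fractional revival *)

Section Revival.
Variable R : realType.
Local Notation toC := (map_mx (real_complex R)).

Lemma not_scalar_revivalP (n : nat) (M : 'M[R]_n) (K : {set 'I_n}) :
  pretty_good_fractional_revival M K <->
  exists2 U : 'M[R[i]]_#|K|, revival_set M K U & forall mu, U <> mu%:M.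
Proof.
split=> [h|[U UR Us] h]; last first.
  by have [mu _ /esym/Us] := h U UR.
apply: contrapT => h'; apply: h => U UR.
apply: contrapT => Us; apply: h'; exists U => // mu Umu; apply: Us.
by exists mu.
Qed.

Section Phases.
Variables (n d : nat) (M : 'M[R]_n) (K : {set 'I_n}).
Variables (E : 'I_d -> 'M[R[i]]_n) (theta : 'I_d -> R).
Hypothesis resE : resolution_of_identity E.
Hypothesis ME : toC M = spectral_sum E (fun j => (theta j)%:C).
Local Notation D := (diag_indicator R[i] K).
Local Notation V x := (spectral_sum E (fun j => cis (x 0 j))).

Lemma torus_unitary (x : 'rV[R]_d) : V x \is unitarymx.
Proof. by apply: spectral_sum_unitary => // j; apply: normr_cis. Qed.

(** By [unitary_blockP] the unitarity of [U] becomes the commutation of [V x] with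
    [D], a condition on the phases alone. *)
Lemma revival_torus (U : 'M[R[i]]_#|K|) : revival_set M K U ->
  exists x : 'rV[R]_d, [/\ U = principal_submx K (V x),
    V x *m D = D *m V x &
    forall e : R, 0 < e -> exists2 t, 0 <= t &
      forall j, `|frac_part (angle theta t j) - x 0 j| < e].
Proof.
case=> clU Uu; have [x Ux xapp] := closure_orbit_torus resE ME clU.
exists x; split=> //; apply/(unitary_blockP K (torus_unitary x)).
by rewrite -[X in X \is _]Ux.
Qed.

Lemma torus_revival (x : 'rV[R]_d) : V x *m D = D *m V x ->
  (forall e : R, 0 < e -> exists2 t, 0 <= t &
     forall j, principal_submx K (E j) != 0 ->
       dist_int (angle theta t j - x 0 j) < e) ->
  revival_set M K (principal_submx K (V x)).
Proof.
move=> VD xapp; split; first exact: (torus_closure_orbit resE ME).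
by apply/(unitary_blockP K (torus_unitary x)).
Qed.

End Phases.

Section Equivalence.
Variables (n d : nat) (M : 'M[R]_n) (K : {set 'I_n}).
Variables (theta : 'I_d -> R) (E : 'I_d -> 'M[R]_n).
Hypothesis symM : M^T = M.
Hypothesis sdM : spectral_decomposition M theta E.
Let resE := spectral_decomposition_resolution symM sdM.
Let ME := spectral_decomposition_sumE sdM.
Local Notation D := (diag_indicator R[i] K).

Lemma pi2_gt0 : 0 < pi *+ 2 :> R.
Proof. by rewrite mulrn_wgt0 // pi_gt0. Qed.

Lemma pi2_neq0 : pi *+ 2 != 0 :> R.
Proof. by rewrite gt_eqF // pi2_gt0. Qed.

(** The phase of a class is that of any of its members, as the phases modulo 1 are
    constant along the support. *)
Lemma revival_nondegenerate : pretty_good_fractional_revival M K ->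
  nondegenerate_partition theta E K.
Proof.
move=> /not_scalar_revivalP[U /(revival_torus resE ME)[x [Ux VD xapp]] Us].
have Vsupp := (spectral_sum_commP resE _ _).1 VD.
have lconst (r : 'I_#|support_classes E K|) a b :
    a \in enum_val r -> b \in enum_val r ->
    cis (x 0 a) = cis (x 0 b).
  move=> ar br; have := support_class_connect resE ar br.
  apply: (connect_invariant (f := fun j => cis (x 0 j))) => a' b'.
  by rewrite eigenvalue_supportE => /Vsupp.
pose rho (r : 'I_#|support_classes E K|) :=
  if [pick j in enum_val r] is Some j then x 0 j else 0.
have cis_rho (r : 'I_#|support_classes E K|) j :
    j \in enum_val r -> cis (rho r) = cis (x 0 j).
  rewrite /rho => jr; case: pickP => [j' j'r|/(_ j)]; last by rewrite jr.
  exact: lconst j'r jr.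
exists rho; split=> [same|e e0].
  (* The default value is taken when all the blocks [(E a)_KK] vanish, in which
     case [U] is equal to [mu%:M] for every [mu]. *)
  pose mu := if [pick a | toC (E a) *m D != 0] is Some a then cis (x 0 a) else 0.
  apply: (Us mu); rewrite Ux; apply/(principal_spectral_sumP resE _ VD) => b bD.
  rewrite /mu; case: pickP => [a aD|/(_ b)]; last by rewrite bD.
  have [ra ara] : exists r : 'I_#|support_classes E K|, a \in enum_val r.
    by apply: mem_support_class; rewrite // notin_Pi0.
  have [rb brb] : exists r : 'I_#|support_classes E K|, b \in enum_val r.
    by apply: mem_support_class; rewrite // notin_Pi0.
  by rewrite -(cis_rho _ _ ara) -(cis_rho _ _ brb); apply/cis_eq; apply: same.
(* Otherwise [U] would be the identity. *)
have [j0 xj0] : exists j, x 0 j != 0.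
  apply/existsP; rewrite -negb_forall; apply/negP => /forallP x0.
  apply: (Us 1); rewrite Ux; apply/(principal_spectral_sumP resE _ VD) => b _.
  by rewrite (eqP (x0 b)); apply: (cis_nat R 0).
(* The bound by [`|x 0 j0|] excludes [t = 0], where all fractional parts are 0. *)
have [|t t0 tx] := xapp (Num.min e `|x 0 j0|).
  by rewrite lt_min e0 normr_gt0.
have tn0 : t != 0.
  apply: contraTneq (tx j0) => ->.
  by rewrite /angle /frac_part !mul0r floor0 subrr sub0r normrN lt_min ltxx andbF.
exists (t / (pi *+ 2)) => [|r j jr].
  by rewrite divr_gt0 ?pi2_gt0 // lt0r tn0.
apply/dist_int_lt; have /cis_eq[z rz] := cis_rho r j jr.
exists (Num.floor (angle theta t j) - z).
have := tx j; rewrite lt_min => /andP[+ _].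
congr (`|_| < e); rewrite rmorphB /= -rz /frac_part /angle.
by rewrite [t / _ * _]mulrAC; ring.
Qed.

(** The phases of the classes are extended by 0 to [Pi0]; the block of [E j]
    vanishes there, so [torus_closure_orbit] asks for no approximation. *)
Lemma nondegenerate_revival : nondegenerate_partition theta E K ->
  pretty_good_fractional_revival M K.
Proof.
case=> rho [nconst rapp]; apply/not_scalar_revivalP.
pose x : 'rV[R]_d := \row_j
  (if [pick r : 'I_#|support_classes E K| | j \in enum_val r] is Some r
   then rho r else 0).
have xE (r : 'I_#|support_classes E K|) j : j \in enum_val r -> x 0 j = rho r.
  rewrite mxE => jr; case: pickP => [r' jr'|/(_ r)]; last by rewrite jr.
  by rewrite (support_class_inj resE jr jr').
have VD : spectral_sum (fun j => toC (E j)) (fun j => cis (x 0 j)) *m D =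
          D *m spectral_sum (fun j => toC (E j)) (fun j => cis (x 0 j)).
  apply/(spectral_sum_commP resE) => a b; rewrite -eigenvalue_supportE => ab.
  have /andP[aD _] := eigenvalue_support_Pi0 resE ab.
  have [r ar] := mem_support_class resE aD.
  by rewrite (xE r) // (xE r) //; apply: support_class_closed ar.
exists (principal_submx K
  (spectral_sum (fun j => toC (E j)) (fun j => cis (x 0 j)))).
  apply: (torus_revival resE ME VD) => e e0.
  have [t t0 tr] := rapp e e0; exists (t * (pi *+ 2)).
    by rewrite mulr_ge0 ?ltW // pi2_gt0.
  move=> j Ej; have jD : (j \in ~: Pi0 E K)%SET.
    by rewrite (notin_Pi0 K resE) -(principal_proj_eq0 resE K j).
  have [r jr] := mem_support_class resE jD.
  rewrite (xE r) //.
  suff -> : angle theta (t * (pi *+ 2)) j = t * theta j by apply: tr.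
  by rewrite /angle mulrAC mulfK // pi2_neq0.
move=> mu /(principal_spectral_sumP resE _ VD) lmu; apply: nconst => r1 r2.
have rmu r : cis (rho r) = mu.
  have [j jr] := support_class_neq0 resE r.
  rewrite -(xE r j jr); apply: lmu; rewrite -notin_Pi0 //.
  exact: support_class_sub jr.
by apply/cis_eq; rewrite !rmu.
Qed.

End Equivalence.

Lemma map_mxX (n : nat) (A : 'M[R]_n) k :
  toC (A ^+ k : 'M[R]_n) = (toC A ^+ k : 'M[R[i]]_n).
Proof.
elim: k => [|k IH]; first exact: map_mx1.
by rewrite !exprS -IH; apply: map_mxM.
Qed.

(** Any nonscalar [U] of the revival set works.  Coordinates of [x] at equal
    eigenvalues coincide, so an eigenvector of [M] is one of the limit [V]. *)
Lemma primitive_revival_not_diag (n : nat) (M : 'M[R]_n) (K : {set 'I_n}) :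
  M^T = M -> (0 < n)%N -> primitive_mx M -> pretty_good_fractional_revival M K ->
  exists2 U : 'M[R[i]]_#|K|, revival_set M K U & ~~ is_diag_mx U.
Proof.
move=> symM n0 [M0 [k _ Mk0]] /not_scalar_revivalP[U UR Us].
have [theta [E [resE ME]]] := symmetric_resolution symM.
have [x [Ux VD xapp]] := revival_torus resE ME UR.
exists U => //; apply/negP => Udiag.
have [||i0 [w [wn0 Ew]]] := @perron_eigenvector R n n E resE theta k n0.
- by move=> a b; rewrite -ME mxE ler0c.
- by move=> a b; rewrite -ME -map_mxX mxE ltcR.
have xeq j : theta j = theta i0 -> x 0 j = x 0 i0.
  move=> thj; apply/eqP; rewrite -subr_eq0 -normr_le0; apply/ler_addgt0Pr => e e0.
  have [|t _ tx] := xapp (e / 2); first by rewrite divr_gt0.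
  have := tx j; have := tx i0; rewrite /angle thj.
  set f := frac_part _ => h1 h2; rewrite add0r.
  have -> : x 0 j - x 0 i0 = (f - x 0 i0) - (f - x 0 j) by ring.
  by rewrite (le_trans (ler_normB _ _)) // [leRHS]splitr lerD // ltW.
set V := spectral_sum E _ in Ux VD.
set mu := cis (x 0 i0).
have Vw : V *m w = mu *: w.
  have [_ _ sumE] := resE.
  rewrite /V /spectral_sum mulmx_suml -[w in RHS]mul1mx -sumE mulmx_suml scaler_sumr.
  apply: eq_bigr => j _; rewrite -scalemxAl.
  have [/xeq -> //|/Ew ->] := eqVneq (theta j) (theta i0).
  by rewrite !scaler0.
apply: (Us mu); apply/matrixP => a b; rewrite !mxE.
have [<-|ab] := eqVneq a b; last first.
  by move/is_diag_mxP: Udiag => ->.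
have := congr1 (fun v : 'cV[R[i]]_#|K| => v a 0)
  (congr1 (mulmx (select_mx R[i] K)) Vw).
have -> : select_mx R[i] K *m (V *m w) = U *m (select_mx R[i] K *m w).
  rewrite Ux principal_submxE -!mulmxA (mulmxA (select_mx R[i] K)^T).
  rewrite select_Tmul (mulmxA V) VD -(mulmxA (diag_indicator _ _)).
  by rewrite (mulmxA _ (diag_indicator _ _)) select_mulD.
rewrite -scalemxAr mxE (bigD1 a) //= big1 => [|c ca]; last first.
  by move/is_diag_mxP: Udiag => ->; rewrite ?mul0r // eq_sym.
rewrite addr0 [in RHS]mxE => /mulIf ->; first by rewrite mulr1n.
rewrite mxE (bigD1 (enum_val a)) //= big1 => [|c ca]; last first.
  by rewrite !mxE eq_sym (negPf ca) mul0r.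
by rewrite !mxE eqxx mul1r addr0.
Qed.

End Revival.

Local Close Scope classical_set_scope.
Theorem theorem2p7 (R : realType) (n : nat) (M : 'M[R]_n) (K : {set 'I_n})
    (symM : M^T = M) (K_neq0 : K != finset.set0) :
  (forall (d : nat) (theta : 'I_d -> R) (E : 'I_d -> 'M[R]_n),
     spectral_decomposition M theta E ->
     (pretty_good_fractional_revival M K <-> nondegenerate_partition theta E K)) /\
  (primitive_mx M -> pretty_good_fractional_revival M K ->
     exists2 U : 'M[R[i]%C]_#|K|, revival_set M K U & ~~ is_diag_mx U).
Proof.
split=> [d theta E sdM|].
  split; first exact: revival_nondegenerate.
  exact: nondegenerate_revival.
apply: primitive_revival_not_diag => //.
by case/finset.set0Pn: K_neq0 => x _; apply: leq_ltn_trans (ltn_ord x).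
Qed.
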